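(* Let $n\in\mathbb{P}$ and $J\subseteq[0,n-1]$. Let $J_0$ be the connected component of $J$ containing $0$ if $0\in J$, and $J_0:=\emptyset$ otherwise, and let $J_1,\ldots,J_s$ be the remaining connected components of $J$, in order. Let $\widetilde m:=\sum_{i=1}^{s}\left\lfloor\frac{|J_i|+1}{2}\right\rfloor$ and $a:=\min\{[0,n]\setminus J\}$. Then $$\sum_{\sigma\in B_n^{J}}(-1)^{\ell(\sigma)}x^{L(\sigma)}=\frac{\prod_{j=a+1}^{n}(1-x^j)}{\prod_{i=1}^{\widetilde m}(1-x^{2i})}\left[\begin{array}{c}\widetilde m\\ \left\lfloor\frac{|J_1|+1}{2}\right\rfloor,\ldots,\left\lfloor\frac{|J_s|+1}{2}\right\rfloor\end{array}\right]_{x^2}.$$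
   Context: Here $\mathbb{P}=\{1,2,\ldots\}$, $[p,q]$ denotes the interval of integers from $p$ to $q$, and $x$ is an indeterminate. $B_n$ is the hyperoctahedral group of permutations $\sigma$ of $[-n,n]$ with $\sigma(-j)=-\sigma(j)$ (so $\sigma(0)=0$), with Coxeter generators $s_0=[-1,2,\ldots,n]$ and $s_i=(i,i+1)(-i,-i-1)$ for $1\le i\le n-1$. For $\sigma\in B_n$, $\ell(\sigma)=\frac12|\{(i,j)\in[-n,n]^2: i<j,\ \sigma(i)>\sigma(j)\}|$ is the Coxeter length and $L(\sigma)=\frac12|\{(i,j)\in[-n,n]^2: i<j,\ \sigma(i)>\sigma(j),\ i\not\equiv j\pmod 2\}|$ is the odd length. For $J\subseteq[0,n-1]$ the quotient is $B_n^J=\{\sigma\in B_n:\sigma(i)<\sigma(i+1)\text{ for all }i\in J\}$. The connected components of $J$ are the intervals of integers $[a_1,b_1],\ldots,[a_r,b_r]$ with $J=[a_1,b_1]\cup\cdots\cup[a_r,b_r]$, $a_i\le b_i$, and $a_{i+1}-b_i>1$. For $n_1+\cdots+n_k=N$ the $q$-multinomial coefficient is $\left[\begin{array}{c}N\\ n_1,\ldots,n_k\end{array}\right]_q=\frac{[N]_q!}{[n_1]_q!\cdots[n_k]_q!}$, with $[r]_q=\frac{1-q^r}{1-q}$, $[r]_q!=\prod_{i=1}^r[i]_q$, $[0]_q!=1$ (it equals $1$ when $N=0$, $k=0$). Empty products equal $1$.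
   Formalization: ℓ(σ) is taken to be the actual Coxeter length (least length of a word in s_0,…,s_{n-1}) rather than the displayed half-count of inversions on [-n,n], which equals 3/2 at s_0 and leaves (-1)^ℓ undefined. *)

(* Defs.v *)
From mathcomp Require Import all_boot all_order all_fingroup all_algebra.

Set Implicit Arguments.
Unset Strict Implicit.
Unset Printing Implicit Defensive.

Import GRing.Theory.

Section WordLength.
Local Open Scope group_scope.
Variable gT : finGroupType.

(* [S ^+ k] is the k-fold product set, i.e. the set of values of the words of
   length k in the letters S. *)
Lemma ex_word (S : {set gT}) (g : gT) : g \in <<S>> -> exists k, g \in S ^+ k.
Proof.
case/gen_prodgP=> k [c cS ->]; exists k.
elim: k c cS => [|k IHk] c cS; first by rewrite big_ord0 expg0 inE.
by rewrite big_ord_recl expgS mem_mulg // IHk.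
Qed.

(* Least length of a word in S with value g (0 if g is not generated by S). *)
Definition word_length (S : {set gT}) (g : gT) : nat :=
  if @idP (g \in <<S>>) is ReflectT gS then ex_minn (ex_word gS) else 0.

End WordLength.

Section Hyperoctahedral.
Local Open Scope group_scope.
Variable n : nat.

(* The interval [-n, n]: the ordinal k stands for the integer k - n.  This shift
   preserves the order, and whether two elements have the same parity;
   negation is [rev_ord]. *)
Definition sint := 'I_(n.*2).+1.

Definition pos (i : nat) : sint := inord (n + i).
Definition neg (i : nat) : sint := inord (n - i).

Definition hyperoct : {set {perm sint}} :=
  [set s : {perm sint} | [forall j, s (rev_ord j) == rev_ord (s j)]].

Definition cox_gen (i : 'I_n) : {perm sint} :=
  if i == 0 :> nat then tperm (neg 1%N) (pos 1%N)
  else tperm (pos i) (pos i.+1) * tperm (neg i) (neg i.+1).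

(* On B_n the length with respect to the Coxeter generators.  It is not half of
   the number of inversions of s on [-n, n]: that number is 3 for s_0. *)
Definition cox_length (s : {perm sint}) : nat :=
  word_length [set cox_gen i | i : 'I_n] s.

Definition odd_length (s : {perm sint}) : nat :=
  #|[set p : sint * sint |
      [&& p.1 < p.2, s p.2 < s p.1 & odd p.1 != odd p.2]]|./2.

Definition hyperoct_quotient (J : {set 'I_n}) : {set {perm sint}} :=
  [set s in hyperoct | [forall i in J, s (pos i) < s (pos i.+1)]].

End Hyperoctahedral.

Section Components.
Variable n : nat.
Implicit Types (J : {set 'I_n}) (cs : seq (nat * nat)).

(* min ([0, n] \ J) *)
Definition min_outside J : nat :=
  [arg min_(k < (ord_max : 'I_n.+1) | [forall i in J, i != k :> nat]) k].

(* A pair (a, b) stands for the interval [a, b] of nat. *)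
Definition conn_components J cs : Prop :=
  [/\ forall k : nat,
        (k \in [seq val i | i in J]) = has (fun p => p.1 <= k <= p.2) cs,
      all (fun p => p.1 <= p.2) cs
    & sorted (fun p p' => 1 < p'.1 - p.2) cs].

Definition itv_card (p : nat * nat) : nat := p.2.+1 - p.1.

Lemma conn_components_exist J : exists cs, conn_components J cs.
Proof.
pose P := [pred k | k \in [seq val i | i in J]].
suff /(_ n 0 (subn0 n) isT) [cs [csP cs_le cs_s _]] :
    forall d m, n - m = d -> m <= n -> exists cs,
    [/\ forall k, (m <= k < n) && P k = has (fun p => p.1 <= k <= p.2) cs,
        all (fun p => p.1 <= p.2) cs,
        sorted (fun p p' => 1 < p'.1 - p.2) cs
      & all (fun p => m <= p.1) cs].
  exists cs; split=> // k; rewrite -csP /=.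
  by case: (boolP (k \in _)) => [/imageP[i _ ->]|]; rewrite ?ltn_ord ?andbF.
elim=> [|d IHd] m Dd le_mn.
  exists [::]; split=> // k /=; apply/negbTE/negP=> /andP[/andP[mk kn] _].
  by move: (leq_ltn_trans mk kn); rewrite -subn_gt0 Dd.
have lt_mn : m < n by rewrite -subn_gt0 Dd.
have Dd1 : n - m.+1 = d by rewrite subnS Dd.
have [cs [csP cs_le cs_s cs_ge]] := IHd m.+1 Dd1 lt_mn.
have split_m k : (m <= k < n) && P k
    = ((k == m) && P m) || ((m < k < n) && P k).
  by have [->|neq_km] := eqVneq k m;
    rewrite ?leqnn ?lt_mn ?ltnn ?orbF //= (leq_eqVlt m) eq_sym (negbTE neq_km).
case Pm: (P m) in split_m; last first.
  exists cs; split=> // [k|]; first by rewrite split_m andbF csP.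
  by apply: sub_all cs_ge => p; apply: ltnW.
case: cs csP cs_le cs_s cs_ge => [|[a b] cs] csP cs_le cs_s cs_ge.
  exists [:: (m, m)]; split; rewrite /= ?leqnn // => k.
  by rewrite split_m csP /= andbT !orbF eqn_leq andbC.
have /andP[/= le_ab cs_le'] := cs_le; have /andP[/= lt_ma cs_ge'] := cs_ge.
have [eq_a|neq_a] := eqVneq a m.+1.
  exists ((m, b) :: cs); split=> //=.
  - move=> k; rewrite split_m csP /= andbT orbA; congr (_ || _).
    rewrite eq_a (leq_eqVlt m) (eq_sym m); case: eqP => //= ->.
    by rewrite ltnW // -eq_a.
  - by apply/andP; split=> //; apply: leq_trans le_ab; apply: ltnW.
  - by case: (cs) cs_s.
  - by rewrite leqnn; apply: sub_all cs_ge' => p; apply: ltnW.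
exists [:: (m, m), (a, b) & cs]; split=> //=.
- by move=> k; rewrite split_m csP /= andbT eqn_leq [(k <= m) && _]andbC.
- by rewrite leqnn; apply/andP; split.
- by rewrite [path _ _ _]cs_s andbT ltn_subRL addn1 ltn_neqAle eq_sym neq_a.
- by rewrite leqnn ltnW //=; apply: sub_all cs_ge' => p; apply: ltnW.
Qed.

End Components.

Section QAnalogues.
Local Open Scope ring_scope.
Variables (F : fieldType) (q : F).

Definition qint (r : nat) : F := (1 - q ^+ r) / (1 - q).
Definition qfact (r : nat) : F := \prod_(1 <= i < r.+1) qint i.

(* Meaningful when N is the sum of ns. *)
Definition qmultinomial (N : nat) (ns : seq nat) : F :=
  qfact N / \prod_(m <- ns) qfact m.

End QAnalogues.

(* The field Q(x). *)
Definition ratfun := {fraction {poly rat}}.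
Definition xvar : ratfun := tofrac ('X : {poly rat})%R.

(* Main.v *)
Require Import Defs.
From mathcomp Require Import all_boot all_order all_fingroup all_algebra.
From mathcomp Require Import zify ring.

Set Implicit Arguments.
Unset Strict Implicit.
Unset Printing Implicit Defensive.

Import GRing.Theory.

(* Colour the positions in [-n, n] symmetrically by c, let L_c count the
   inversions between positions of different colours (L = L_c for c the parity),
   and let F(c, J) be the sum of (-1)^l x^(L_c) over the quotient of J.  Exchanging
   the positions i and i + 1 at a descent gives the factor -x^[c i <> c (i+1)] and
   exchanges the two colours.  Hence F(c, J) = 0 if i and i + 1 are blocks of size 1
   with the same colour.

   If the last position e of a block [m, e] with alternating colours is detached,
   its value can be moved to the left until it is in its place in the block;
   the colour of e moves along.  Two places next to a position with the
   colour of e give the same colouring with opposite signs, and only the last place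
   and, if the block has even size 2k, the first one survive:
     F(c, J \ {e-1}) = F(c, J) - [size even] x^k F(c', J),
   where c' is c with the colours of the block exchanged.  For the block of 0 the
   value can also become negative, and one gets
     F(parity, J \ {e-1}) = (1 - x^e) F(parity, J).
   Iterating the first identity for c and c', a block of size b with 2k <= b <= 2k+1
   can be cut into blocks of size 1 at the cost of the factor
   prod_(i <= k) (1 - x^(2i)): the terms with a colouring c' vanish if the blocks
   are treated from left to right.  The case J = [0, n-1] of the second identity
   gives F(parity, set0) = prod_(j <= n) (1 - x^j). *)

(** * Inversions *)

Section Inversions.
Variable n : nat.
Implicit Types (s t : {perm sint n}) (D : rel (sint n)).

Definition inversions D s : {set sint n * sint n} :=
  [set p : sint n * sint n | [&& p.1 < p.2, s p.2 < s p.1 & D p.1 p.2]].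

Lemma eq_inversions D D' s : D =2 D' -> inversions D s = inversions D' s.
Proof. by move=> DD'; apply/setP=> p; rewrite !inE DD'. Qed.

Lemma inversions1 D : inversions D 1%g = set0.
Proof.
by apply/setP=> p; rewrite !inE !perm1; case: ltngtP => //=; rewrite ?andbF.
Qed.

Lemma tperm_adjacent_lt (i j p q : sint n) : j = i.+1 :> nat ->
  (p, q) != (i, j) -> (p, q) != (j, i) ->
  (tperm i j p < tperm i j q) = (p < q).
Proof.
move=> ij; rewrite !xpair_eqE -!(inj_eq val_inj) /=.
have val_tperm r : tperm i j r = (if r == i :> nat then j : nat
    else if r == j :> nat then i : nat else r) :> nat.
  by case: tpermP => [->|->|/eqP + /eqP]; rewrite ?eqxx -?(inj_eq val_inj) /=;
    [| case: eqP => // -> | do 2 case: eqP => //].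
rewrite !val_tperm; case: eqP; case: eqP; case: eqP; case: eqP; lia.
Qed.

(** Applying the transposition to both entries of a pair keeps the order of every pair except the
    one formed by [i] and [j]. That pair becomes an inversion and gives the summand [D i j]. *)
Lemma card_inversions_adjacent D s (i j : sint n) : symmetric D ->
  j = i.+1 :> nat -> s i < s j ->
  #|inversions D (tperm i j * s)|
    = #|inversions (fun p q => D (tperm i j p) (tperm i j q)) s| + D i j.
Proof.
move=> symD ij sij; set t := tperm i j.
pose f (p : sint n * sint n) := (t p.1, t p.2).
have fK : involutive f by move=> [p q]; rewrite /f /= !tpermK.
rewrite -(card_imset _ (inv_inj fK)).
have imf p : (p \in [set f p | p in inversions D (t * s)])
    = (f p \in inversions D (t * s)).
  by rewrite -{1}(fK p) mem_imset //; apply: inv_inj.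
have nji : ~~ (s j < s i) by rewrite -leqNgt ltnW.
have nlt_ji : (j < i) = false by rewrite ij ltnNge leqnSn.
have lt_ij : i < j by rewrite ij.
case Dij: (D i j); last first.
  rewrite addn0; apply: eq_card => -[p q]; rewrite imf !inE /= !permM !tpermK.
  have [|neq1] := eqVneq (p, q) (i, j).
    by case=> -> ->; rewrite (negbTE nji) /= !andbF.
  have [|neq2] := eqVneq (p, q) (j, i); last by rewrite tperm_adjacent_lt.
  by case=> -> ->; rewrite tpermL tpermR Dij !andbF.
rewrite addnC.
have disj : (j, i) \notin inversions (fun p q => D (t p) (t q)) s.
  by rewrite inE /= nlt_ji.
have := cardsU1 (j, i) (inversions (fun p q => D (t p) (t q)) s).
rewrite disj /= => <-.
apply: eq_card => -[p q]; rewrite imf !inE /= !permM !tpermK.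
have [|neq1] := eqVneq (p, q) (i, j).
  by case=> -> ->; rewrite (negbTE nji) andbF andbF orbF xpair_eqE
    -(inj_eq val_inj) /= (ltn_eqF lt_ij).
have [|neq2] := eqVneq (p, q) (j, i); last by rewrite tperm_adjacent_lt.
by case=> -> ->; rewrite tpermL tpermR Dij sij lt_ij.
Qed.

End Inversions.

(** * The Coxeter generators *)

Lemma tperm_braid (T : finType) (x y z : T) : x != z -> y != z ->
  (tperm x y * (tperm y z * tperm x y))%g = tperm x z.
Proof.
move=> xz yz; have := tpermJ y z (tperm x y).
by rewrite conjgE tpermV tpermR tpermD.
Qed.

Section Generators.
Variable n : nat.
Implicit Types (s t : {perm sint n}) (D : rel (sint n)) (i : 'I_n) (k : nat).
Local Notation pos := (pos n).
Local Notation neg := (neg n).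

Lemma val_pos k : k <= n -> pos k = n + k :> nat.
Proof. by move=> kn; rewrite inordK; lia. Qed.

Lemma val_neg k : neg k = n - k :> nat.
Proof. by rewrite inordK; lia. Qed.

Lemma rev_pos k : k <= n -> rev_ord (pos k) = neg k.
Proof. by move=> kn; apply: val_inj; rewrite /= val_pos // val_neg; lia. Qed.

Lemma rev_neg k : k <= n -> rev_ord (neg k) = pos k.
Proof. by move=> kn; rewrite -rev_pos // rev_ordK. Qed.

Lemma neg0 : neg 0 = pos 0.
Proof. by rewrite /Defs.neg /Defs.pos addn0 subn0. Qed.

Lemma signedP (p : sint n) :
  exists2 k, k <= n & p = pos k \/ p = neg k.
Proof.
have lt_p := ltn_ord p; have [le_np|lt_pn] := leqP n p.
  by exists (p - n); [lia | left; apply: val_inj; rewrite /= val_pos; lia].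
by exists (n - p); [lia | right; apply: val_inj; rewrite /= val_neg; lia].
Qed.

Lemma hyperoctP s :
  reflect (forall p, s (rev_ord p) = rev_ord (s p)) (s \in hyperoct n).
Proof. by rewrite inE; apply: 'forall_eqP. Qed.

Lemma hyperoctM s t :
  s \in hyperoct n -> t \in hyperoct n -> (s * t)%g \in hyperoct n.
Proof.
by move=> /hyperoctP sP /hyperoctP tP; apply/hyperoctP=> p; rewrite !permM sP tP.
Qed.

Lemma tperm_rev (p q r : sint n) :
  tperm (rev_ord p) (rev_ord q) (rev_ord r) = rev_ord (tperm p q r).
Proof.
case: (tpermP p q r) => [->|->|/eqP rp /eqP rq]; rewrite ?tpermL ?tpermR //.
by rewrite tpermD // (inj_eq rev_ord_inj) eq_sym.
Qed.

Lemma tperm_commute (p q p' q' : sint n) :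
    p != p' -> p != q' -> q != p' -> q != q' ->
  commute (tperm p q) (tperm p' q').
Proof.
by move=> n1 n2 n3 n4; rewrite /commute conjgC tpermJ !tpermD // eq_sym.
Qed.

Lemma cox_gen0E i : i = 0 :> nat -> cox_gen i = tperm (neg 1) (pos 1).
Proof. by rewrite /cox_gen => ->. Qed.

Lemma cox_genE i : 0 < i ->
  cox_gen i = (tperm (pos i) (pos i.+1) * tperm (neg i) (neg i.+1))%g.
Proof. by rewrite /cox_gen; case: eqP => // ->. Qed.

Lemma cox_gen_commute i : 0 < i ->
  commute (tperm (pos i) (pos i.+1)) (tperm (neg i) (neg i.+1)).
Proof.
move=> i_gt0; have lt_in := ltn_ord i.
by apply: tperm_commute; rewrite -(inj_eq val_inj) /= val_pos ?val_neg; lia.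
Qed.

Lemma cox_gen_hyperoct i : cox_gen i \in hyperoct n.
Proof.
have lt_in := ltn_ord i; apply/hyperoctP=> p.
have [i0|i_gt0] := posnP i.
  by rewrite cox_gen0E // -tperm_rev rev_pos ?rev_neg 1?tpermC //; lia.
rewrite cox_genE // !permM -tperm_rev !rev_neg // 1?ltnW //.
by rewrite -permM cox_gen_commute // permM -!rev_pos ?tperm_rev // ltnW.
Qed.

Lemma cox_gen_mul i : (cox_gen i * cox_gen i = 1)%g.
Proof.
have [i0|i_gt0] := posnP i; first by rewrite cox_gen0E // tperm2.
rewrite cox_genE // {1}cox_gen_commute // mulgA -(mulgA (tperm (neg i) _)).
by rewrite tperm2 mulg1 tperm2.
Qed.

Lemma cox_genK i : involutive (mulg (cox_gen i)).
Proof. by move=> s; rewrite mulgA cox_gen_mul mul1g. Qed.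

Lemma cox_genKp i : involutive (cox_gen i).
Proof. by move=> p; rewrite -permM cox_gen_mul perm1. Qed.

Lemma cox_gen_pos i : 0 < i -> cox_gen i (pos i) = pos i.+1.
Proof.
move=> i_gt0; have lt_in := ltn_ord i; rewrite cox_genE // permM tpermL tpermD //;
by rewrite -(inj_eq val_inj) /= val_pos ?val_neg; lia.
Qed.

Lemma cox_gen_posS i : 0 < i -> cox_gen i (pos i.+1) = pos i.
Proof. by move=> i_gt0; rewrite -cox_gen_pos // cox_genKp. Qed.

Lemma cox_gen_pos_id i k : 0 < i -> k <= n -> k != i -> k != i.+1 ->
  cox_gen i (pos k) = pos k.
Proof.
move=> i_gt0 kn ki kiS; have lt_in := ltn_ord i.
rewrite cox_genE // permM !tpermD //;
by rewrite -(inj_eq val_inj) /= !val_pos ?val_neg; lia.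
Qed.

Lemma cox_gen0_pos1 i : i = 0 :> nat -> cox_gen i (pos 1) = neg 1.
Proof. by move=> i0; rewrite cox_gen0E // tpermR. Qed.

Lemma cox_gen0_pos_id i k : i = 0 :> nat -> k <= n -> k != 1 ->
  cox_gen i (pos k) = pos k.
Proof.
move=> i0 kn k1; have lt_in := ltn_ord i; rewrite cox_gen0E // tpermD //;
by rewrite -(inj_eq val_inj) /= !val_pos ?val_neg; lia.
Qed.

Lemma hyperoct_neg s k : s \in hyperoct n -> k <= n ->
  s (neg k) = n.*2 - s (pos k) :> nat.
Proof.
by move=> /hyperoctP sP kn; rewrite -rev_pos // sP /=; lia.
Qed.

Lemma hyperoct_pos0 s : s \in hyperoct n -> s (pos 0) = n :> nat.
Proof.
move=> sP; have:= hyperoct_neg sP (leq0n n); rewrite neg0.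
by have := ltn_ord (s (pos 0)); lia.
Qed.

(** For [0 < i] the generator is a product of two commuting adjacent transpositions, mirror images
    of each other, and each contributes [D (pos i) (pos i.+1)]. For [i = 0] it is (-1 0)(0 1)(-1 0):
    the outer factors contribute as before, the middle one [D (neg 1) (pos 1)], which is false. *)
Lemma card_inversions_cox_gen D s i :
    symmetric D -> (forall p q, D (rev_ord p) (rev_ord q) = D p q) ->
    ~~ D (neg 1) (pos 1) ->
    s \in hyperoct n -> s (pos i) < s (pos i.+1) ->
  #|inversions D (cox_gen i * s)|
    = #|inversions (fun p q => D (cox_gen i p) (cox_gen i q)) s|
      + (D (pos i) (pos i.+1)).*2.
Proof.
move=> symD revD D11 sP si; have lt_in := ltn_ord i.
have [i0|i_gt0] := posnP i.
  have s0 := hyperoct_pos0 sP; rewrite i0 s0 in si.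
  have n1 := hyperoct_neg sP (ltn_ord i); rewrite i0 in n1.
  have lt_s1 := ltn_ord (s (pos 1)).
  have d1 : neg 1 != pos 0.
    by rewrite -(inj_eq val_inj) /= val_pos ?val_neg; lia.
  have d2 : pos 1 != pos 0.
    by rewrite -(inj_eq val_inj) /= !val_pos; lia.
  have d3 : neg 1 != pos 1.
    by rewrite -(inj_eq val_inj) /= val_pos ?val_neg; lia.
  have c0E : cox_gen i
    = (tperm (neg 1) (pos 0) * (tperm (pos 0) (pos 1) * tperm (neg 1) (pos 0)))%g.
    by rewrite cox_gen0E // (tperm_braid d3) // eq_sym.
  rewrite {1}c0E -!mulgA card_inversions_adjacent //; first last.
  - rewrite !permM (tpermD (z := neg 1)) 1?eq_sym // !tpermL.
    by rewrite (tpermD (z := pos 1)) ?s0 // eq_sym.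
  - by rewrite val_pos // val_neg; lia.
  rewrite card_inversions_adjacent //; first last.
  - by rewrite !permM tpermR (tpermD (z := pos 1)) ?n1 //; [lia | rewrite eq_sym].
  - by rewrite !val_pos //; lia.
  rewrite card_inversions_adjacent //; first last.
  - by rewrite n1 s0; lia.
  - by rewrite val_pos // val_neg; lia.
  have e1 : tperm (pos 0) (pos 1) (neg 1) = neg 1 by rewrite tpermD // eq_sym.
  have e2 : tperm (neg 1) (pos 0) (pos 1) = pos 1 by rewrite tpermD // eq_sym.
  rewrite e1 e2 !tpermL tpermR e2 (negbTE D11) addn0.
  have -> : D (neg 1) (pos 0) = D (pos 0) (pos 1).
    by rewrite symD -revD rev_pos // neg0 rev_neg; lia.
  rewrite i0 -addnA addnn; congr (_ + _); apply/eq_card/setP/eq_inversions.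
  move=> p q /=.
  by rewrite cox_gen0E // -(tperm_braid (y := pos 0) d3) ?permM // eq_sym.
have sN := hyperoct_neg sP (ltnW lt_in); have sNS := hyperoct_neg sP lt_in.
have ltS := ltn_ord (s (pos i.+1)); have lt0 := ltn_ord (s (pos i)).
have nidx (p q : sint n) : p != q :> nat -> p != q by rewrite -(inj_eq val_inj).
have d1 : pos i != neg i by apply: nidx; rewrite val_pos ?val_neg //; lia.
have d2 : pos i != neg i.+1 by apply: nidx; rewrite val_pos ?val_neg //; lia.
have d3 : pos i.+1 != neg i by apply: nidx; rewrite val_pos ?val_neg //; lia.
have d4 : pos i.+1 != neg i.+1 by apply: nidx; rewrite val_pos ?val_neg //; lia.
rewrite {1}cox_genE // -mulgA card_inversions_adjacent //; first last.
- by rewrite !permM !tpermD // eq_sym.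
- by rewrite !val_pos //; lia.
rewrite (tpermC (neg i)) card_inversions_adjacent //; first last.
- by rewrite sN sNS; lia.
- by rewrite !val_neg; lia.
rewrite !(tpermD (x := pos i)) //.
have -> : D (neg i.+1) (neg i) = D (pos i) (pos i.+1).
  by rewrite symD -revD !rev_neg //; lia.
rewrite -addnA addnn; congr (_ + _); apply/eq_card/setP/eq_inversions.
by move=> p q /=; rewrite cox_genE // cox_gen_commute // !permM !(tpermC (neg i)).
Qed.
End Generators.

(** * Lengths and signs *)

Section Lengths.
Variable n : nat.
Implicit Types (s t : {perm sint n}) (i : 'I_n) (k : nat) (c : nat -> bool).
Local Notation pos := (pos n).
Local Notation neg := (neg n).

Definition sabs (p : sint n) : nat := (p - n) + (n - p).

(** The action of [cox_gen i] on absolute values; the sign change [s_0] acts trivially. *)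
Definition swapn (i k : nat) : nat :=
  if i == 0 then k else if k == i then i.+1 else if k == i.+1 then i else k.

(** One-line notation, with the values shifted by [n] as in [sint]: a value below [n] is a negative
    integer. *)
Definition window s k : nat := s (pos k).

Lemma sabs_rev p : sabs (rev_ord p) = sabs p.
Proof. by rewrite /sabs /=; have := ltn_ord p; lia. Qed.

Lemma sabs_pos k : k <= n -> sabs (pos k) = k.
Proof. by move=> kn; rewrite /sabs val_pos //; lia. Qed.

Lemma sabs_cox_gen i p : sabs (cox_gen i p) = swapn i (sabs p).
Proof.
have lt_in := ltn_ord i.
have [k kn kp] := signedP p.
suff : sabs (cox_gen i (pos k)) = swapn i k.
  case: kp => ->; first by rewrite sabs_pos.
  by rewrite -rev_pos // (hyperoctP _ (cox_gen_hyperoct i)) !sabs_rev sabs_pos.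
rewrite /swapn; case: posnP => [i0|i_gt0].
  have [->|k1] := eqVneq k 1; last by rewrite cox_gen0_pos_id ?sabs_pos.
  by rewrite cox_gen0_pos1 // -rev_pos ?sabs_rev ?sabs_pos //; lia.
have [->|ki] := eqVneq k i; first by rewrite cox_gen_pos // sabs_pos.
have [->|kiS] := eqVneq k i.+1; first by rewrite cox_gen_posS // sabs_pos // ltnW.
by rewrite cox_gen_pos_id // sabs_pos.
Qed.

Lemma window0 s : s \in hyperoct n -> window s 0 = n.
Proof. exact: hyperoct_pos0. Qed.

Lemma window_le s k : window s k <= n.*2.
Proof. by rewrite -ltnS; apply: ltn_ord. Qed.

Lemma window_inj s k l : k <= n -> l <= n -> window s k = window s l -> k = l.
Proof.
move=> kn ln /val_inj/perm_inj/(congr1 val) /=.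
by rewrite !val_pos // => /addnI.
Qed.

Lemma window_cox_gen s i k : 0 < i -> k <= n ->
  window (cox_gen i * s) k = window s (swapn i k).
Proof.
move=> i_gt0 kn; rewrite /window permM /swapn (gtn_eqF i_gt0).
have [->|ki] := eqVneq k i; first by rewrite cox_gen_pos.
have [->|kiS] := eqVneq k i.+1; first by rewrite cox_gen_posS.
by rewrite cox_gen_pos_id.
Qed.

Lemma window_cox_gen0 s i k : s \in hyperoct n -> i = 0 :> nat -> k <= n ->
  window (cox_gen i * s) k = if k == 1 then n.*2 - window s 1 else window s k.
Proof.
move=> sP i0 kn; rewrite /window permM; have [k1|k1] := eqVneq k 1.
  by rewrite k1 cox_gen0_pos1 // hyperoct_neg //; lia.
by rewrite cox_gen0_pos_id.
Qed.

Lemma window_cox_gen_descent s i : s \in hyperoct n ->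
  (window (cox_gen i * s) i.+1 < window (cox_gen i * s) i)
    = (window s i < window s i.+1).
Proof.
move=> sP; have lt_in := ltn_ord i; have [i0|i_gt0] := posnP i.
  rewrite !window_cox_gen0 ?(ltnW lt_in) // i0 /= window0 //.
  by have := window_le s 1; lia.
rewrite !window_cox_gen ?(ltnW lt_in) // /swapn.
by rewrite (gtn_eqF i_gt0) eqxx gtn_eqF ?eqxx.
Qed.

Lemma window_ascent_or s i :
  (window s i.+1 < window s i) = ~~ (window s i < window s i.+1).
Proof.
rewrite -leqNgt ltn_neqAle andb_idl // => _; apply/eqP=> /window_inj.
by have := ltn_ord i; lia.
Qed.

(* The Coxeter length: an inversion (p, q) is counted together with its mirror
   image (-q, -p), and the sign changes are counted by the inversions with 0
   instead of the antipodal pairs. *)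
Definition hlen s := #|inversions (fun p q => q != rev_ord p) s|./2.

(** Colours depend on absolute values only, so antipodal pairs are not counted. On B_n the counted
    inversions thus come in mirror pairs (p, q), (-q, -p), and the halving is exact. *)
Definition clen c s := #|inversions (fun p q => c (sabs p) != c (sabs q)) s|./2.

Lemma hlen_cox_gen s i : s \in hyperoct n -> window s i < window s i.+1 ->
  hlen (cox_gen i * s) = (hlen s).+1.
Proof.
move=> sP si; have lt_in := ltn_ord i; rewrite /hlen card_inversions_cox_gen //.
- rewrite (_ : pos i.+1 != _); last first.
    rewrite rev_pos 1?ltnW // -(inj_eq val_inj) /= val_pos ?val_neg //; lia.
  rewrite /= doubleS addn2 /=; congr (_./2.+1); apply/eq_card/setP/eq_inversions.
  move=> p q /=; rewrite -(hyperoctP _ (cox_gen_hyperoct i)).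
  by rewrite (inj_eq perm_inj).
- by move=> p q; rewrite -(inj_eq rev_ord_inj) rev_ordK eq_sym.
- by move=> p q; rewrite (inj_eq rev_ord_inj).
by rewrite rev_neg ?eqxx //; lia.
Qed.

Lemma eq_clen c c' s : (forall k, k <= n -> c k = c' k) -> clen c s = clen c' s.
Proof.
move=> cc'; congr (_./2); apply/eq_card/setP/eq_inversions=> p q.
by rewrite !cc' //; move: (ltn_ord p) (ltn_ord q); rewrite /sabs; lia.
Qed.

Lemma clen_cox_gen c s i : s \in hyperoct n -> window s i < window s i.+1 ->
  clen c (cox_gen i * s) = clen (c \o swapn i) s + (c i != c i.+1).
Proof.
move=> sP si; have lt_in := ltn_ord i.
rewrite /clen card_inversions_cox_gen //.
- rewrite halfD odd_double andbF doubleK add0n !sabs_pos ?(ltnW lt_in) //.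
  congr (_./2 + _); apply/eq_card/setP/eq_inversions=> p q /=.
  by rewrite !sabs_cox_gen.
- by move=> p q; rewrite eq_sym.
- by move=> p q; rewrite !sabs_rev.
by rewrite -(@rev_pos _ 1) ?sabs_rev ?eqxx //; lia.
Qed.

Lemma hlen_cox_gen_odd s i : s \in hyperoct n ->
  odd (hlen (cox_gen i * s)) = ~~ odd (hlen s).
Proof.
move=> sP; have [si|] := boolP (window s i < window s i.+1).
  by rewrite hlen_cox_gen.
rewrite -window_ascent_or -[in X in X -> _](cox_genK i s).
have gsP := hyperoctM (cox_gen_hyperoct i) sP.
rewrite window_cox_gen_descent // => si.
by have := hlen_cox_gen gsP si; rewrite cox_genK => ->; rewrite /= negbK.
Qed.

(** The window starts at [n] and has [n] strict increases below the bound [n.*2], so each of them is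
    by 1. *)
Lemma window_increasing_eq1 s : s \in hyperoct n ->
  (forall i, window s i < window s i.+1) -> s = 1%g.
Proof.
move=> sP incs.
have ge_s k : k <= n -> forall l, k + l <= n -> window s k + l <= window s (k + l).
  move=> kn; elim=> [|l IHl] kln; first by rewrite !addn0.
  have lt_kl : k + l < n by lia.
  by have := incs (Ordinal lt_kl); have := IHl (ltnW lt_kl); rewrite /= !addnS; lia.
have s_pos k : k <= n -> s (pos k) = pos k.
  move=> kn; apply: val_inj; rewrite /= val_pos //.
  have := ge_s 0 (leq0n n) k kn; have := ge_s k kn (n - k).
  rewrite window0 // add0n subnKC // => /(_ (leqnn n)).
  by have := window_le s n; rewrite /window; lia.
apply/permP=> p; rewrite perm1; have [k kn [->|->]] := signedP p; first exact: s_pos.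
by rewrite -rev_pos // (hyperoctP _ sP) s_pos.
Qed.

Lemma hyperoct_gen s : s \in hyperoct n -> s \in <<[set cox_gen i | i : 'I_n]>>%g.
Proof.
have [m] := ubnP (hlen s); elim: m s => // m IHm s le_s sP.
have [/forallP incs|] := boolP [forall i : 'I_n, window s i < window s i.+1].
  by rewrite (window_increasing_eq1 sP incs) group1.
rewrite negb_forall => /existsP[i]; rewrite -window_ascent_or => si.
have gsP := hyperoctM (cox_gen_hyperoct i) sP.
rewrite -(cox_genK i s); apply: groupM; first by rewrite mem_gen ?imset_f.
apply: IHm => //.
move: si; rewrite -[in X in X -> _](cox_genK i s) window_cox_gen_descent // => si.
by have := hlen_cox_gen gsP si; rewrite cox_genK; lia.
Qed.

Lemma hlen1 : hlen 1%g = 0.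
Proof. by rewrite /hlen inversions1 cards0. Qed.

Lemma clen1 c : clen c 1%g = 0.
Proof. by rewrite /clen inversions1 cards0. Qed.

(** Each letter of a word flips the parity of [hlen], so all words with value [s] have the same
    parity, in particular a shortest one. *)
Lemma odd_cox_length s : s \in hyperoct n -> odd (cox_length s) = odd (hlen s).
Proof.
move=> sP; rewrite /cox_length /word_length.
case: {-}_ / idP => [gs|]; last by rewrite hyperoct_gen.
case: ex_minnP => k + _; elim: k s {sP gs} => [|k IHk] s.
  by rewrite expg0 => /set1P->; rewrite hlen1.
rewrite expgS => /mulsgP[g t /imsetP[i _ ->] tk ->] /=.
suff tP : t \in hyperoct n by rewrite hlen_cox_gen_odd // (IHk t).
elim: k t tk {IHk} => [|k IHk] t.
  by rewrite expg0 => /set1P->; apply/hyperoctP=> p; rewrite !perm1.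
rewrite expgS => /mulsgP[g' u /imsetP[j _ ->] /IHk uP ->].
by rewrite hyperoctM ?cox_gen_hyperoct.
Qed.

Lemma odd_length_clen s : odd_length s = clen odd s.
Proof.
congr (_./2); apply: eq_card => p; rewrite !inE; congr [&& _, _ & _].
(* The shift by [n] in the encoding changes both parities alike. *)
have oddE q : odd (sabs q) = odd q (+) odd n by rewrite /sabs; lia.
by rewrite !oddE; case: (odd p.1); case: (odd p.2); case: (odd n).
Qed.

End Lengths.

(** * Sums over coloured quotients *)

Lemma swapnL j : 0 < j -> swapn j j = j.+1.
Proof. by move=> j0; rewrite /swapn gtn_eqF // eqxx. Qed.

Lemma swapnR j : 0 < j -> swapn j j.+1 = j.
Proof. by move=> j0; rewrite /swapn (gtn_eqF j0) (gtn_eqF (ltnSn j)) eqxx. Qed.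

Lemma swapnD j k : k != j -> k != j.+1 -> swapn j k = k.
Proof. by move=> /negbTE kj /negbTE kjS; rewrite /swapn kj kjS if_same. Qed.

Section ColouredSums.
Variables (n : nat) (F : fieldType) (x : F).
Implicit Types (s t : {perm sint n}) (i : 'I_n) (k m e j : nat).
Implicit Types (c : nat -> bool) (J : pred nat) (w : nat -> nat).
Implicit Types (P Q : (nat -> nat) -> bool).

(** Arbitrary conditions on the window are allowed, since the intermediate sums, with one free value
    in a block, do not run over quotients. *)
Definition wsum c P : F :=
  (\sum_(s in hyperoct n | P (window s)) (-1) ^+ hlen s * x ^+ clen c s)%R.

Definition incr J w := [forall i : 'I_n, J i ==> (w i < w i.+1)].

Definition qsum c J := wsum c (incr J).

Lemma incrP J w :
  reflect (forall k, k < n -> J k -> w k < w k.+1) (incr J w).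
Proof.
apply: (iffP forallP) => [incw k kn Jk | incw i]; last exact/implyP/incw.
by have /implyP := incw (Ordinal kn); apply.
Qed.

Lemma eq_wsum_colour c c' P : (forall k, k <= n -> c k = c' k) ->
  wsum c P = wsum c' P.
Proof. by move=> cc'; apply: eq_bigr => s _; rewrite (eq_clen _ cc'). Qed.

Lemma eq_wsum c P Q :
    (forall s, s \in hyperoct n -> P (window s) = Q (window s)) ->
  wsum c P = wsum c Q.
Proof.
by move=> PQ; apply: eq_bigl => s; case: (boolP (s \in _)) => //= /PQ.
Qed.

Lemma eq_qsum c J J' : (forall k, k < n -> J k = J' k) -> qsum c J = qsum c J'.
Proof.
by move=> JJ'; apply: eq_wsum => s _; apply: eq_forallb => i; rewrite JJ'.
Qed.

(** The part of the sum with an ascent at [i] is described by [Q]. The part with a descent is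
    reindexed by [cox_gen i], which turns the descent into an ascent; [Q'] describes the result. *)
Lemma wsum_step c P Q Q' i :
    (forall s, s \in hyperoct n ->
      P (window s) && (window s i < window s i.+1) = Q (window s)) ->
    (forall s, s \in hyperoct n ->
      P (window (cox_gen i * s)) && (window s i < window s i.+1)
      = Q' (window s)) ->
  (wsum c P = wsum c Q - x ^+ (c i != c i.+1) * wsum (c \o swapn i) Q')%R.
Proof.
move=> PQ PQ'; rewrite /wsum.
rewrite (bigID (fun s => window s i < window s i.+1)) /=; congr (_ + _)%R.
  by apply: eq_bigl => s; rewrite -andbA; case: (boolP (s \in _)) => //= /PQ.
rewrite (reindex_inj (mulgI (cox_gen i))) /= big_distrr -sumrN /=.
apply: eq_big => [s | s].
  have -> : (cox_gen i * s \in hyperoct n)%g = (s \in hyperoct n).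
    apply/idP/idP => [gsP|]; last by apply/hyperoctM/cox_gen_hyperoct.
    by rewrite -(cox_genK i s) hyperoctM ?cox_gen_hyperoct.
  case: (boolP (s \in _)) => //= sP.
  by rewrite -PQ' // -window_ascent_or window_cox_gen_descent.
rewrite -window_ascent_or => /andP[/andP[gsP _]].
have sP : s \in hyperoct n.
  by rewrite -(cox_genK i s) hyperoctM ?cox_gen_hyperoct.
rewrite window_cox_gen_descent // => si.
by rewrite hlen_cox_gen // clen_cox_gen // exprS exprD; ring.
Qed.

(** * Moving the free value of a block to the left *)

Section Block.
Variables (J : pred nat) (m e : nat).
Hypothesis J_block : forall k, m <= k < e -> J k.
Hypothesis J_left : forall k, k.+1 = m -> ~~ J k.
Hypothesis J_right : ~~ J e.
Hypothesis le_en : e <= n.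

(* The values at [m, e] except the one at j are increasing; the one at j is
   only required to be smaller than the next one. *)
Definition left_free j w :=
  incr (fun k => J k && (k.+1 != j)) w && ((m < j < e) ==> (w j.-1 < w j.+1)).

Lemma left_free_first c : wsum c (left_free m) = qsum c J.
Proof.
apply: eq_wsum => s _; rewrite /left_free ltnn andbT; apply: eq_forallb => k /=.
by case: eqP => [/J_left/negbTE->|]; rewrite ?andbT.
Qed.

Lemma left_free_last c :
  wsum c (left_free e) = qsum c (fun k => J k && (k.+1 != e)).
Proof. by apply: eq_wsum => s _; rewrite /left_free ltnn !andbF andbT. Qed.

(** If there is an ascent at [j], the free value at [j.+1] is in its place in the block. Otherwise
    exchanging the two positions makes [j] the free one. *)
Lemma left_free_step c j : 0 < j -> m <= j < e ->
  (wsum c (left_free j.+1)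
   = qsum c J - x ^+ (c j != c j.+1) * wsum (c \o swapn j) (left_free j))%R.
Proof.
move=> j0 /andP[mj je]; have jn : j < n by apply: leq_trans le_en.
have Jj : J j by apply: J_block; rewrite mj.
apply: (@wsum_step _ _ _ _ (Ordinal jn)) => s sP /=.
  apply/andP/incrP => [[/andP[/incrP incw _] ltj] k kn Jk|incw].
    by have [->//|kj] := eqVneq k j; apply: incw => //; rewrite Jk eqSS.
  split; last exact: incw.
  apply/andP; split; first by apply/incrP=> k kn /andP[Jk _]; apply: incw.
  apply/implyP=> /andP[_ jSe]; apply: ltn_trans (incw _ jn Jj) _.
  apply: incw; first exact: leq_trans le_en.
  by apply: J_block; rewrite jSe; lia.
have wE k : k <= n -> window (cox_gen (Ordinal jn) * s) k = window s (swapn j k).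
  exact: window_cox_gen.
set w' := window (_ * s); set w := window s in wE *.
have w'j : w' j = w j.+1 by rewrite /w' wE ?swapnL // ltnW.
have w'jS : w' j.+1 = w j by rewrite /w' wE ?swapnR.
have w'D k : k <= n -> k != j -> k != j.+1 -> w' k = w k.
  by move=> kn kj kjS; rewrite /w' wE // swapnD.
apply/andP/andP => [[/andP[/incrP incw /implyP wjj] wj]|[/incrP incw /implyP wjj]].
  split.
    apply/incrP => k kn /andP[Jk kSj].
    have [->//|kj] := eqVneq k j; have [kjS|kjS] := eqVneq k j.+1.
      (* [j.+1] satisfies [J] and [e] does not, so the block goes on beyond [j.+1]. *)
      have jSe : j.+1 < e.
        rewrite ltn_neqAle je andbT; apply: contraNneq J_right => <-.
        by rewrite -kjS.
      rewrite kjS -w'j -w'D; try lia.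
      by apply: wjj; rewrite jSe; lia.
    by rewrite -!w'D; try lia; apply: incw; rewrite ?Jk.
  apply/implyP=> /andP[lt_mj _].
  have jE : j.-1.+1 = j by lia.
  rewrite -w'j -w'D; try lia.
  rewrite -[in X in _ < X]jE; apply: incw; first by lia.
  by rewrite J_block; lia.
have wj : w j < w j.+1 by apply: incw; rewrite ?Jj //; lia.
have wjS : j.+1 < n -> J j.+1 -> w j.+1 < w j.+2.
  by move=> jSn JjS; apply: incw; rewrite ?JjS //; lia.
split=> //; apply/andP; split.
  apply/incrP => k kn /andP[Jk kj].
  have [kjS|kjS] := eqVneq k j.+1.
    rewrite kjS w'jS w'D; try lia.
    by apply: ltn_trans wj _; apply: wjS; rewrite -kjS.
  have [kSj|kSj] := eqVneq k.+1 j.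
    rewrite w'D ?kSj ?w'j; try lia.
    rewrite -[k]/(k.+1.-1) kSj; apply: wjj; rewrite je andbT.
    rewrite ltn_neqAle mj andbT; apply: contraTneq Jk => mj'; apply: J_left.
    by rewrite mj'.
  by rewrite !w'D; try lia; apply: incw; rewrite ?Jk.
apply/implyP=> /andP[_ jSe]; rewrite w'j w'D; try lia.
by apply: wjS; [lia | apply: J_block; lia].
Qed.

End Block.

(** * The block of 0: sign change and way back to the right *)

Section CentralBlock.
Variables (J : pred nat) (e : nat).
Hypothesis J_block : forall k, k < e -> J k.
Hypothesis J_right : ~~ J e.
Hypothesis e_gt0 : 0 < e.
Hypothesis le_en : e <= n.

(* As [left_free] at 0, once the free value has become negative and has been
   replaced by its opposite. *)
Definition right_free j w :=
  incr (fun k => J k && (k != j)) w && ((j < e) ==> (w j.-1 < w j.+1)).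

Lemma right_free_last c : wsum c (right_free e) = qsum c J.
Proof.
apply: eq_wsum => s _; rewrite /right_free ltnn andbT; apply: eq_forallb => k /=.
by case: eqP => [->|]; rewrite ?andbT // (negbTE J_right).
Qed.

Lemma right_free_step c j : 0 < j < e ->
  (wsum c (right_free j)
   = qsum c J - x ^+ (c j != c j.+1) * wsum (c \o swapn j) (right_free j.+1))%R.
Proof.
move=> /andP[j0 je]; have jn : j < n by apply: leq_trans le_en.
have Jj := J_block je; have jE : j.-1.+1 = j by lia.
have Jj1 : J j.-1 by apply: J_block; lia.
apply: (@wsum_step _ _ _ _ (Ordinal jn)) => s sP /=.
  apply/andP/incrP => [[/andP[/incrP incw _] ltj] k kn Jk|incw].
    by have [->//|kj] := eqVneq k j; apply: incw => //; rewrite Jk.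
  split; last exact: incw.
  apply/andP; split; first by apply/incrP=> k kn /andP[Jk _]; apply: incw.
  apply/implyP=> _; apply: ltn_trans (incw _ jn Jj).
  by rewrite -[in X in _ < X]jE; apply: incw => //; lia.
have wE k : k <= n -> window (cox_gen (Ordinal jn) * s) k = window s (swapn j k).
  exact: window_cox_gen.
set w' := window (_ * s); set w := window s in wE *.
have w'j : w' j = w j.+1 by rewrite /w' wE ?swapnL // ltnW.
have w'jS : w' j.+1 = w j by rewrite /w' wE ?swapnR.
have w'D k : k <= n -> k != j -> k != j.+1 -> w' k = w k.
  by move=> kn kj kjS; rewrite /w' wE // swapnD.
have w'j1 : w' j.-1 = w j.-1 by apply: w'D; lia.
apply/andP/andP => [[/andP[/incrP incw /implyP wjj] wj]|[/incrP incw /implyP wjj]].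
  split.
    apply/incrP => k kn /andP[Jk kSj].
    have [->//|kj] := eqVneq k j; have [kjS|kjS] := eqVneq k j.-1.
      by rewrite kjS jE -w'jS -w'j1; apply: wjj.
    by rewrite -!w'D; try lia; apply: incw; rewrite ?Jk.
  apply/implyP=> jSe.
  rewrite -w'jS -w'D; try lia.
  by apply: incw; [lia | rewrite J_block // gtn_eqF].
have wj : w j < w j.+1 by apply: incw; rewrite ?Jj //; lia.
have wj1 : w j.-1 < w j.
  by rewrite -[in X in _ < X]jE; apply: incw; rewrite ?Jj1 //; lia.
split=> //; apply/andP; split; last by apply/implyP; rewrite w'jS w'j1.
apply/incrP => k kn /andP[Jk kj].
have [kjS|kjS] := eqVneq k j.+1.
  rewrite kjS w'jS w'D; try lia.
  apply: wjj; rewrite ltn_neqAle je andbT; apply: contraNneq J_right => <-.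
  by rewrite -kjS.
have [kSj|kSj] := eqVneq k.+1 j.
  rewrite w'D ?kSj ?w'j; try lia.
  by rewrite -[k]/(k.+1.-1) kSj; apply: ltn_trans wj1 wj.
by rewrite !w'D; try lia; apply: incw; rewrite ?Jk.
Qed.

(** The free value at 1 is either positive, hence in its place, or negative. In the second case
    [s_0] makes it positive without changing the colouring, and its place has to be looked for to
    the right. *)
Lemma left_free_sign_change c :
  (wsum c (left_free J 0 e 1)
   = qsum c J - x ^+ (c 0 != c 1) * wsum c (right_free 1))%R.
Proof.
have n0 : 0 < n by apply: leq_trans le_en.
have J0 := J_block e_gt0.
apply: (@wsum_step _ _ _ _ (Ordinal n0)) => s sP /=.
  apply/andP/incrP => [[/andP[/incrP incw _] ltj] k kn Jk|incw].
    by case: k kn Jk => // k kn Jk; apply: incw; rewrite ?Jk.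
  split; last exact: incw.
  apply/andP; split; first by apply/incrP=> k kn /andP[Jk _]; apply: incw.
  apply/implyP=> e1; apply: ltn_trans (incw _ n0 J0) _.
  by apply: incw; [lia | apply: J_block].
have wE k : k <= n -> window (cox_gen (Ordinal n0) * s) k
    = if k == 1 then n.*2 - window s 1 else window s k.
  exact: window_cox_gen0.
have w0 := window0 sP; have w'0 := wE 0 (leq0n n); have w'1 := wE 1 n0.
move: w0 w'0 w'1 wE; set w' := window (_ * s); set w := window s => /=.
move=> w0 w'0 w'1 wE.
apply/andP/andP => [[/andP[/incrP incw /implyP wjj] wj]|[/incrP incw /implyP wjj]].
  split.
    apply/incrP => -[//|[|k]] kn /andP[Jk // _].
    by have := incw _ kn; rewrite !wE ?Jk //; [apply | lia].
  by apply/implyP=> e1; have := wjj e1; rewrite w'0 !wE //; lia.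
have w01 : w 0 < w 1 by apply: incw; rewrite ?J0.
split=> //; apply/andP; split.
  apply/incrP => -[|[|k]] kn /andP[Jk //  _].
    have e1 : 1 < e.
      by rewrite ltn_neqAle e_gt0 andbT; apply: contraNneq J_right => <-.
    by have := wjj e1; rewrite w'1 !wE //=; lia.
  by have := incw _ kn; rewrite !wE ?Jk //; [apply | lia].
by apply/implyP=> e1; have := wjj e1; rewrite w'0 !wE //; lia.
Qed.

End CentralBlock.

(** Multiplication by [cox_gen i] respects the conditions in [J] and the colouring but reverses the
    sign, so the terms cancel in pairs. *)
Lemma qsum_equal_colours c J (i : nat) : i < n -> c i = c i.+1 ->
    (forall k, k.+1 = i -> ~~ J k) -> ~~ J i -> ~~ J i.+1 ->
  qsum c J = 0%R.
Proof.
move=> lt_in ci J1 Ji JiS; have le_in := ltnW lt_in.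
pose P w := incr J w && (w i < w i.+1).
rewrite /qsum (@wsum_step c _ P P (Ordinal lt_in)) //= ?ci ?eqxx.
  rewrite expr0 mul1r (@eq_wsum_colour _ c) ?subrr // => k kn /=.
  rewrite /swapn; case: eqP => // _.
  by have [->|_] := eqVneq k i; [|case: eqP => [->|]].
move=> s sP; congr (_ && _); apply: eq_forallb => k.
case Jk: (J k) => //=.
have ki : k != i :> nat by apply: contraNneq Ji => <-.
have kiS : k != i.+1 :> nat by apply: contraNneq JiS => <-.
have kSi : k.+1 != i by apply: contraTneq Jk => /J1.
have lt_kn := ltn_ord k; have [i0|i_gt0] := posnP i.
  by rewrite !window_cox_gen0 //; try lia; rewrite !ifN //; lia.
by rewrite !window_cox_gen ?swapnD //; lia.
Qed.

Lemma qsum_full c J : (forall k, k < n -> J k) -> qsum c J = 1%R.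
Proof.
move=> JT; rewrite /qsum /wsum (big_pred1 1%g).
  by rewrite hlen1 clen1 expr0 mul1r.
move=> s; apply/andP/eqP => [[sP /incrP incw]|->].
  by apply: window_increasing_eq1 => // i; apply: incw; rewrite ?JT.
split; first by apply/hyperoctP=> p; rewrite !perm1.
by apply/incrP=> k kn _; rewrite /window !perm1 !val_pos; lia.
Qed.

End ColouredSums.

(** * Detaching the last position of a block *)

Section Recurrences.
Local Open Scope ring_scope.
Variables (F : fieldType) (x : F).
Implicit Types f K : nat -> F.

(** For a free value at distance [t] from the leftmost place and [b] the distance of the last place:
    [K] is the sum with that value free, [f] the sum over the full quotient with the same
    colouring. *)
Lemma alternating_recurrence f K (b : nat) :
    (forall t, (t < b)%N -> K t.+1 = f t.+1 - x ^+ odd (b - t) * K t) ->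
    (forall t, (t < b)%N -> ~~ odd (b - t) -> f t.+1 = f t) ->
  K b = f b - x ^+ uphalf b * (if odd b then K 0%N else f 0%N - K 0%N).
Proof.
move=> KS fS.
(* Where [b - t] is odd, two steps multiply [K] by [x], because the two values of [f] that enter are
   equal and cancel. *)
have Kt t : (t < b)%N -> odd (b - t) ->
    K t = x ^+ t./2 * (if odd t then f 0%N - K 0%N else K 0%N).
  have [k] := ubnP t; elim: k t => // k IHk [|[|t]] lt_tk tb bt.
  - by rewrite expr0 mul1r.
  - have b0 : ~~ odd (b - 0) by lia.
    by rewrite KS ?fS ?(negbTE b0) ?expr0 ?mul1r //; lia.
  have bt1 : ~~ odd (b - t.+1) by lia.
  have bt0 : odd (b - t) by lia.
  rewrite KS; last by lia.
  rewrite KS; last by lia.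
  rewrite (IHk t) //; try lia.
  rewrite (fS t.+1) //; last by lia.
  rewrite (negbTE bt1) bt0 /= negbK expr0 expr1 exprS.
  by case: (odd t); ring.
case: b KS fS Kt => [|b] KS fS Kt; first by rewrite /=; ring.
rewrite KS // (Kt b) ?leqnn ?subSnn //= expr1.
by case: (odd b); rewrite /= exprS; ring.
Qed.

(** For the way back of a negated value: [t] is now the distance from the last place, where the
    value is in order and [K 0 = f 0]. *)
Lemma alternating_recurrence2 f K (b : nat) : K 0%N = f 0%N ->
    (forall t, (t < b)%N -> K t.+1 = f t.+1 - x ^+ (~~ odd t) * K t) ->
    (forall t, (t < b)%N -> odd t -> f t.+1 = f t) ->
  K b = if odd b then f b - x ^+ uphalf b * f 0%N else x ^+ uphalf b * f 0%N.
Proof.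
move=> K0; elim: b => [|b IHb] KS fS; first by rewrite /= mul1r.
rewrite KS // IHb => [|t tb|t tb]; last 2 first.
- by apply: KS; apply: ltnW.
- by apply: fS; apply: ltnW.
have := fS b (ltnSn b); rewrite /= uphalf_half; case: (odd b) => /= [->//|_].
  by rewrite add1n exprS; ring.
by rewrite add0n expr1 exprS; ring.
Qed.

End Recurrences.

(** * Colourings that arise when one position moves through a block *)

Section Insertion.
Implicit Types (c : nat -> bool) (m e j k : nat).

(* The colouring once the value at position e has been moved to position j. *)
Definition insert_colour c e j k : bool :=
  if k < j then c k else if k == j then c e else if k <= e then c k.-1 else c k.

Lemma insert_colour_last c e k : insert_colour c e e k = c k.
Proof. by rewrite /insert_colour; case: ltngtP => // ->. Qed.

Lemma insert_colour_swapl c e j k : 0 < j < e ->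
  (insert_colour c e j.+1 \o swapn j) k = insert_colour c e j k.
Proof.
move=> /andP[j0 je]; rewrite /= /insert_colour.
have [->|kj] := eqVneq k j; first by rewrite swapnL // !ltnn eqxx.
have [->|kjS] := eqVneq k j.+1.
  by rewrite swapnR // ltnSn ltnNge leqnSn /= je.
by rewrite swapnD // (negbTE kjS) ltnS (leq_eqVlt k) (negbTE kj).
Qed.

Lemma insert_colour_swapr c e j k : 0 < j < e ->
  (insert_colour c e j \o swapn j) k = insert_colour c e j.+1 k.
Proof.
move=> je; have j0 : 0 < j by case/andP: je.
rewrite -[k in RHS](_ : swapn j (swapn j k) = k).
  exact/esym/(insert_colour_swapl c (swapn j k) je).
have [->|kj] := eqVneq k j; first by rewrite swapnL // swapnR.
have [->|kjS] := eqVneq k j.+1; first by rewrite swapnR // swapnL.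
by rewrite !swapnD.
Qed.

(** This gives the coincidences between consecutive values of [f] in the recurrences. *)
Lemma insert_colour_eq c e j k : j < e -> c j = c e ->
  insert_colour c e j.+1 k = insert_colour c e j k.
Proof.
move=> je cj; rewrite /insert_colour ltnS leq_eqVlt.
have [->|kj] := eqVneq k j; first by rewrite ltnn.
case: ltnP => //= le_jk.
by have [->|//] := eqVneq k j.+1; rewrite je /=.
Qed.

Lemma insert_colour_at c e j : insert_colour c e j j = c e.
Proof. by rewrite /insert_colour ltnn eqxx. Qed.

Lemma insert_colour_before c e j : insert_colour c e j.+1 j = c j.
Proof. by rewrite /insert_colour ltnSn. Qed.

Lemma insert_colour_after c e j : j < e -> insert_colour c e j j.+1 = c j.
Proof. by move=> je; rewrite /insert_colour ltnNge leqnSn gtn_eqF // je. Qed.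

Definition alternating c m e := forall k, m <= k < e -> c k.+1 = ~~ c k.

Lemma alternating_neq c m e j : alternating c m e -> m <= j <= e ->
  (c j != c e) = odd (e - j).
Proof.
move=> alt_c /andP[mj je]; rewrite -{1}(subnKC je).
have : j + (e - j) <= e by rewrite subnKC.
elim: (e - j) => [|d IHd] jd; first by rewrite addn0 eqxx.
rewrite addnS alt_c /=; last by lia.
by rewrite -IHd; [case: (c j); case: (c _) | lia].
Qed.

Definition flip c m e k : bool := c k (+) (m <= k <= e).

(** The insertion is a cyclic shift of the colours of the block; as the block is alternating of even
    size, the shift exchanges the colours. *)
Lemma alternating_insert c m e : alternating c m e -> m <= e -> odd (e - m) ->
  insert_colour c e m =1 flip c m e.
Proof.
move=> alt_c me oddem k; rewrite /insert_colour /flip.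
case: ltngtP => [|mk|->] /=; rewrite ?addbF //.
  case: leqP => ke; rewrite ?addbF // addbT.
  by case: k mk ke => // k mk ke; rewrite alt_c ?negbK //= -ltnS mk.
move: oddem; rewrite -(alternating_neq alt_c) me ?leqnn //.
by case: (c m); case: (c e).
Qed.

Lemma alternating_flip c m e : alternating c m e -> alternating (flip c m e) m e.
Proof.
move=> alt_c k /andP[mk ke]; rewrite /flip alt_c ?mk ?ke ?(ltnW ke) ?(leqW mk) //.
by rewrite !addbT.
Qed.

Lemma flipK c m e k : flip (flip c m e) m e k = c k.
Proof. exact: addbK. Qed.

Lemma alternatingS c m e : alternating c m e.+1 -> alternating c m e.
Proof. by move=> alt_c k /andP[mk ke]; apply: alt_c; rewrite mk ltnW. Qed.

End Insertion.

(** * The two identities for detaching the last position *)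

Section Quotients.
Local Open Scope ring_scope.
Variables (n : nat) (F : fieldType) (x : F).
Implicit Types (c : nat -> bool) (J : pred nat) (m e j k : nat).
Local Notation qsum := (qsum n x).

Lemma left_free_insert c J m e j :
    (forall k, (m <= k < e)%N -> J k) -> (forall k, k.+1 = m -> ~~ J k) ->
    ~~ J e -> (e <= n)%N -> (0 < j)%N -> (m <= j < e)%N ->
  wsum n x (insert_colour c e j.+1) (left_free n J m e j.+1)
    = qsum (insert_colour c e j.+1) J - x ^+ (c j != c e)
        * wsum n x (insert_colour c e j) (left_free n J m e j).
Proof.
move=> Jb Jl Jr en j0 mje; have /andP[mj je] := mje.
rewrite left_free_step // insert_colour_before insert_colour_at.
congr (_ - _ * _); apply: eq_wsum_colour => k _.
by apply: insert_colour_swapl; rewrite j0.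
Qed.

(** The free value moves from [e] to [m], where its freedom is no relaxation of [J]: this is
    [K 0 = f 0]. It removes the correction term for blocks of odd size and makes it a full quotient,
    with the colours exchanged, for even size. *)
Lemma qsum_shrink_block c J m e :
    (0 < m <= e)%N -> (e <= n)%N -> alternating c m e ->
    (forall k, (m <= k < e)%N -> J k) -> (forall k, k.+1 = m -> ~~ J k) ->
    ~~ J e ->
  qsum c (fun k => J k && (k.+1 != e)) = qsum c J
    - (if odd (e - m) then x ^+ uphalf (e - m) * qsum (flip c m e) J else 0).
Proof.
move=> /andP[m0 me] en alt_c Jb Jl Jr.
pose f t := qsum (insert_colour c e (m + t)) J.
pose K t := wsum n x (insert_colour c e (m + t)) (left_free n J m e (m + t)).
have K0 : K 0%N = f 0%N by rewrite /K /f addn0 left_free_first.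
have Ke : K (e - m)%N = qsum c (fun k => J k && (k.+1 != e)).
  rewrite /K subnKC // left_free_last //; apply: eq_wsum_colour => k _.
  exact: insert_colour_last.
have fe : f (e - m)%N = qsum c J.
  by rewrite /f subnKC //; apply: eq_wsum_colour => k _; apply: insert_colour_last.
rewrite -Ke -fe (alternating_recurrence (f := f) (x := x)); first last.
- move=> t tm; rewrite -subnDA -(alternating_neq alt_c); last by lia.
  rewrite negbK => /eqP ct; apply: eq_wsum_colour => k _; rewrite addnS.
  by apply: insert_colour_eq => //; lia.
- move=> t tm; rewrite -subnDA -(alternating_neq alt_c); last by lia.
  by rewrite /K /f addnS left_free_insert //; lia.
rewrite K0 subrr; case: ifP => oddem; last by rewrite mulr0.
congr (_ - _ * _).
rewrite /f addn0; apply: eq_wsum_colour => k _; exact: alternating_insert.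
Qed.

Lemma qsum_shrink_central J e :
    (0 < e <= n)%N -> (forall k, (k < e)%N -> J k) -> ~~ J e ->
  qsum odd (fun k => J k && (k.+1 != e)) = (1 - x ^+ e) * qsum odd J.
Proof.
(* Position 0 is fixed, so the free value runs through the places 1 to [e.+1] and both recurrences
   have length [e]. [K] describes the way to the left, [M] the way back, counted from the right
   end. *)
move=> /andP[e0 en] Jb Jr; case: e e0 en Jb Jr => // e _ en Jb Jr.
have Jb' k : (0 <= k < e.+1)%N -> J k by apply: Jb.
have Jl k : k.+1 = 0%N -> ~~ J k by [].
have odd_neq j : (j <= e.+1)%N -> (odd j != odd e.+1) = odd (e.+1 - j).
  by move=> je; rewrite oddB //; case: (odd j); case: (odd e.+1).
pose ins := insert_colour odd e.+1.
have ins_last k : ins e.+1 k = odd k by apply: insert_colour_last.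
pose f t := qsum (ins t.+1) J.
pose K t := wsum n x (ins t.+1) (left_free n J 0 e.+1 t.+1).
pose M t := wsum n x (ins (e - t).+1) (right_free n J e.+1 (e - t).+1).
have Ke : K e = qsum odd (fun k => J k && (k.+1 != e.+1)).
  rewrite /K left_free_last //; exact: eq_wsum_colour.
have fe : f e = qsum odd J by exact: eq_wsum_colour.
have K0 : K 0%N = f 0%N - x ^+ odd e.+1 * M e.
  rewrite /K /M subnn left_free_sign_change // /ins insert_colour_at.
  by rewrite insert_colour_before; case: (odd e.+1).
have KE := alternating_recurrence (x := x) (f := f) (K := K) (b := e).
rewrite -Ke -fe KE; first last.
- move=> t tm; rewrite -subSS -odd_neq; last by lia.
  rewrite negbK => /eqP ct; apply: eq_wsum_colour => k _.
  by apply: insert_colour_eq => //; lia.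
- move=> t tm; rewrite -subSS -odd_neq; last by lia.
  by rewrite /K /f left_free_insert //; lia.
have ME : M e = if odd e then f 0%N - x ^+ uphalf e * f e else x ^+ uphalf e * f e.
  have := alternating_recurrence2 (x := x) (f := fun t => f (e - t)%N)
    (K := M) (b := e).
  rewrite subnn subn0; apply.
  - by rewrite /M subn0 right_free_last.
  - move=> t te; have eE : (e - t = (e - t.+1).+1)%N by lia.
    rewrite /M right_free_step //; last by lia.
    rewrite /ins insert_colour_at insert_colour_after; last by lia.
    rewrite eq_sym odd_neq; last by lia.
    rewrite (_ : odd (e.+1 - (e - t.+1).+1) = ~~ odd t); last by lia.
    rewrite eE; congr (_ - _ * _); apply: eq_wsum_colour => k _.
    by apply: insert_colour_swapr; lia.
  move=> t te oddt; have eE : (e - t = (e - t.+1).+1)%N by lia.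
  rewrite /f eE; apply/esym/eq_wsum_colour => k _; apply: insert_colour_eq.
    by lia.
  by apply/eqP; rewrite -[_ == _]negbK odd_neq; lia.
(* For either parity of [e] the term [f 0] cancels. The way left, the way back and the sign change
   contribute the three summands of the exponent. *)
have ee : e.+1 = (odd e.+1 + uphalf e + uphalf e)%N by lia.
rewrite [in X in 1 - X]ee !exprD K0 ME /=.
by case: (odd e) => /=; rewrite ?expr0 ?expr1; ring.
Qed.

End Quotients.

(** * Cutting the components *)

Section Components.
Local Open Scope ring_scope.
Variables (n : nat) (F : fieldType) (x : F).
Implicit Types (c : nat -> bool) (J : pred nat) (m e d k : nat) (p : nat * nat).
Local Notation qsum := (qsum n x).

(** The q-Pochhammer symbol (x^2; x^2)_m. *)
Definition even_factors m : F := \prod_(1 <= i < m.+1) (1 - x ^+ (2 * i)).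

Lemma even_factorsS m :
  even_factors m.+1 = even_factors m * (1 - x ^+ (2 * m.+1)).
Proof. by rewrite /even_factors big_nat_recr. Qed.

Definition add_block J m e : pred nat := fun k => J k || (m <= k < e)%N.

(** Induction on [d], detaching the last position of the block for [c] and for the exchanged
    colouring. *)
Lemma qsum_add_block c J m d :
    (0 < m)%N -> (m + d <= n)%N -> alternating c m (m + d) ->
    (forall k, (m <= k.+1)%N -> (k <= m + d)%N -> ~~ J k) ->
  even_factors (d.+1)./2 * qsum c (add_block J m (m + d))
    = qsum c J + (if odd d then x ^+ uphalf d * qsum (flip c m (m + d)) J else 0).
Proof.
move=> m0; elim: d c => [|d IHd] c mdn alt_c Jout.
  rewrite addn0 addr0 /even_factors big_nil mul1r; apply: eq_qsum => k _.
  by rewrite /add_block leqNgt andNb orbF.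
have IH c' : alternating c' m (m + d.+1) ->
    even_factors (d.+1)./2 * qsum c' (add_block J m (m + d))
    = qsum c' J + (if odd d then x ^+ uphalf d * qsum (flip c' m (m + d)) J else 0).
  move=> alt_c'; apply: IHd => [||k mk kd].
  - by lia.
  - by apply: alternatingS; rewrite -addnS.
  by apply: Jout => //; lia.
have shrink c' : alternating c' m (m + d.+1) ->
    qsum c' (add_block J m (m + d)) = qsum c' (add_block J m (m + d.+1))
    - (if ~~ odd d then x ^+ (d./2).+1
         * qsum (flip c' m (m + d.+1)) (add_block J m (m + d.+1)) else 0).
  move=> alt_c'.
  have := @qsum_shrink_block n F x c' (add_block J m (m + d.+1)) m (m + d.+1).
  rewrite addKn /= => <- //.
  - apply: eq_qsum => k _; rewrite /add_block addnS eqSS ltnS.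
    have [->|kd] := eqVneq k (m + d)%N.
      by rewrite ltnn !andbF orbF (negbTE (Jout _ _ _)) //; lia.
    by rewrite andbT (leq_eqVlt k) (negbTE kd).
  - by lia.
  - by move=> k kmd; rewrite /add_block kmd orbT.
  - move=> k km; rewrite /add_block (negbTE (Jout _ _ _)) //; lia.
  by rewrite /add_block ltnn andbF orbF Jout //; lia.
have := IH c alt_c; rewrite shrink //; case oddd: (odd d) => /=.
  have -> : d./2.+1 = uphalf d by lia.
  rewrite oddd subr0 addr0 => ->; rewrite [X in _ + X](_ : _ = 0) ?addr0 //.
  (* The induction hypothesis exchanges the colours only up to [m + d], so [m + d] and its successor
     now have the same colour. *)
  rewrite (@qsum_equal_colours n F x _ J (m + d)%N) ?mulr0 //.
  - by lia.
  - rewrite /flip alt_c; last by lia.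
    by rewrite leq_addr leqnn ltnn andbF addbF addbT.
  - by move=> k kmd; apply: Jout; lia.
  - by apply: Jout; lia.
  - by apply: Jout; lia.
(* The block has even size: the identities for the two colourings form a linear system, and
   eliminating the sum for the exchanged one leaves the factor 1 - x^(2k) with k = d/2 + 1. *)
have := IH _ (alternating_flip alt_c).
rewrite shrink ?oddd /=; last exact: alternating_flip.
have -> K : qsum (flip (flip c m (m + d.+1)) m (m + d.+1)) K = qsum c K.
  by apply: eq_wsum_colour => k _; rewrite flipK.
rewrite !addr0 => <- <-.
have -> : uphalf d = d./2 by lia.
rewrite even_factorsS mulnC exprM; ring.
Qed.

Lemma qsum_add_first_block J m e : (0 < m <= e)%N -> (e <= n)%N ->
    (forall k, (k <= e)%N -> ~~ J k) ->
  even_factors (e - m).+1./2 * qsum odd (add_block J m e) = qsum odd J.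
Proof.
move=> /andP[m0 me] en Jout.
have := @qsum_add_block odd J m (e - m) m0; rewrite subnKC // => -> //; first last.
- by move=> k _; apply: Jout.
case: ifP => _; rewrite ?addr0 // -[RHS]addr0; congr (_ + _).
(* After the exchange [m] has the colour of [m.-1], and both are blocks of size 1. *)
rewrite (@qsum_equal_colours n F x _ J m.-1) ?mulr0 //.
- by lia.
- rewrite prednK // /flip me leqnn addbT leqNgt.
  by case: m m0 {me} => //= m; rewrite ltnSn addbF negbK.
- by move=> k km; apply: Jout; lia.
- by apply: Jout; lia.
by apply: Jout; lia.
Qed.

Lemma qsum_add_central_block J e : (e <= n)%N -> (forall k, (k <= e)%N -> ~~ J k) ->
  \prod_(1 <= j < e.+1) (1 - x ^+ j) * qsum odd (add_block J 0 e) = qsum odd J.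
Proof.
elim: e => [|e IHe] en Jout.
  rewrite big_nil mul1r; apply: eq_qsum => k _.
  by rewrite /add_block andbF orbF.
rewrite -IHe 1?ltnW // => [|k ke]; last by apply/Jout/ltnW.
rewrite big_nat_recr //= -mulrA -qsum_shrink_central //.
- congr (_ * _); apply: eq_qsum => k _; rewrite /add_block eqSS ltnS.
  have [->|ke] := eqVneq k e; last by rewrite andbT (leq_eqVlt k) (negbTE ke).
  by rewrite ltnn !andbF orbF (negbTE (Jout _ _)).
- by move=> k ke; rewrite /add_block ke orbT.
by rewrite /add_block ltnn orbF Jout.
Qed.

Definition covered cs : pred nat := fun k => has (fun p => p.1 <= k <= p.2)%N cs.

(** The bound is [p.2.+1] because conditions on the interval [p] make a block whose last position is
    [p.2.+1]. *)
Lemma covered_path p cs k : all (fun p => p.1 <= p.2)%N cs ->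
    path (fun p p' => 1 < p'.1 - p.2)%N p cs -> (k <= p.2.+1)%N ->
  ~~ covered cs k.
Proof.
elim: cs p => //= q cs IHcs p /andP[q_le cs_le] /andP[pq cs_path] kp.
rewrite negb_or (IHcs q) ?andbT //; last by lia.
by lia.
Qed.

(** The first component is added to the later ones, so there are only blocks of size 1 on its
    left. *)
Lemma qsum_covered cs : all (fun p => p.1 <= p.2)%N cs ->
    sorted (fun p p' => 1 < p'.1 - p.2)%N cs -> all (fun p => p.2 < n)%N cs ->
    all (fun p => p.1 != 0)%N cs ->
  \prod_(p <- cs) even_factors (itv_card p).+1./2 * qsum odd (covered cs)
    = qsum odd pred0.
Proof.
elim: cs => [|p cs IHcs] /=; first by rewrite big_nil mul1r.
move=> /andP[p_le cs_le] cs_path /andP[pn cs_n] /andP[p0 cs0].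
rewrite -IHcs ?(path_sorted cs_path) // big_cons.
rewrite -(@qsum_add_first_block (covered cs) p.1 p.2.+1) //; first last.
- by move=> k kp; apply: covered_path cs_path kp.
- by rewrite lt0n p0 ltnW.
rewrite mulrCA !mulrA; congr (_ * _); apply: eq_qsum => k _.
by rewrite /add_block ltnS orbC.
Qed.

Lemma qsum_pred0 : qsum odd pred0 = \prod_(1 <= j < n.+1) (1 - x ^+ j).
Proof.
rewrite -(@qsum_add_central_block pred0 n) // qsum_full ?mulr1 //.
Qed.

(** The powers of [1 - x ^+ 2] in the q-factorials cancel, as the lower entries add up to the upper
    one. *)
Lemma even_factors_qmultinomial ns : 1 - x ^+ 2 != 0 ->
  qmultinomial (x ^+ 2) (sumn ns) ns
    = even_factors (sumn ns) / \prod_(m <- ns) even_factors m.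
Proof.
move=> nz.
have qfactE m : qfact (x ^+ 2) m = even_factors m / (1 - x ^+ 2) ^+ m.
  elim: m => [|m IHm]; first by rewrite /qfact /even_factors !big_nil divr1.
  rewrite /qfact big_nat_recr //= -/(qfact _ _) IHm even_factorsS /qint -exprM.
  by rewrite (exprSr (1 - x ^+ 2)) invfM; ring.
rewrite /qmultinomial qfactE; under eq_bigr do rewrite qfactE.
rewrite big_split /= (_ : \prod_(m <- ns) _^-1 = ((1 - x ^+ 2) ^+ sumn ns)^-1).
  by rewrite invfM invrK mulrACA mulVf ?mulr1 // expf_neq0.
rewrite prodfV; congr (_^-1); elim: ns => [|m ns IHns]; first by rewrite big_nil.
by rewrite big_cons IHns /= exprD.
Qed.

End Components.

(** * The formula over the field of rational functions *)

Lemma min_outsideE n (J : {set 'I_n}) a : a <= n ->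
    (forall k, k < a -> k \in [seq val i | i in J]) ->
    a \notin [seq val i | i in J] ->
  min_outside J = a.
Proof.
move=> an Ja Jna; rewrite /min_outside; case: arg_minnP.
  (* The default [ord_max] stands for [n], which is outside every [J]. *)
  by apply/forall_inP=> i _; rewrite /= neq_ltn ltn_ord.
move=> k /forall_inP kJ kmin; apply/eqP; rewrite eqn_leq; apply/andP; split.
  apply: (kmin (Ordinal (an : a < n.+1))); apply/forall_inP=> i iJ /=.
  by apply: contraNneq Jna => <-; apply: image_f.
rewrite leqNgt; apply/negP=> /Ja/imageP[i iJ ki].
by have := kJ i iJ; rewrite ki eqxx.
Qed.

Lemma xvar_factor_neq0 j : 0 < j -> (1 - xvar ^+ j != 0)%R.
Proof.
move=> j0; rewrite /xvar -tofracXn -tofrac1 -tofracB tofrac_eq0 -opprB oppr_eq0.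
by rewrite -size_poly_eq0 size_XnsubC.
Qed.

Local Open Scope ring_scope.

Theorem theorem5p4 (n : nat) (n_gt0 : (0 < n)%N) (J : {set 'I_n})
    (cs : seq (nat * nat)) (csJ : conn_components J cs) :
  let floors := [seq (itv_card p).+1./2 | p <- cs & (p.1 != 0)%N] in
  let mt := sumn floors in
  let a := min_outside J in
  \sum_(s in hyperoct_quotient J) (-1) ^+ cox_length s * xvar ^+ odd_length s
  = (\prod_(a.+1 <= j < n.+1) (1 - xvar ^+ j))
      / (\prod_(1 <= i < mt.+1) (1 - xvar ^+ (2 * i)))
      * qmultinomial (xvar ^+ 2) mt floors.
Proof.
move=> floors mt a; have [csP cs_le cs_s] := csJ.
have sumE : \sum_(s in hyperoct_quotient J)
    (-1) ^+ cox_length s * xvar ^+ odd_length s = qsum n xvar odd (covered cs).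
  apply: eq_big => [s|s]; last first.
    by rewrite inE => /andP[sP _]; rewrite odd_length_clen -signr_odd
      odd_cox_length // signr_odd.
  rewrite inE; congr (_ && _); apply: eq_forallb => i; rewrite /covered -csP.
  by rewrite mem_image //; apply: val_inj.
have cs_n : all (fun p => p.2 < n)%N cs.
  apply/allP=> p p_cs; have p_le := allP cs_le p p_cs.
  suff /imageP[i _ ->] : p.2 \in [seq val i | i in J] by apply: ltn_ord.
  by rewrite csP; apply/hasP; exists p => //; rewrite p_le leqnn.
have even_factors_neq0 m : even_factors xvar m != 0.
  rewrite /even_factors big_nat prodf_seq_neq0; apply/allP=> i _.
  by apply/implyP=> /andP[i0 _]; rewrite xvar_factor_neq0 // muln_gt0.
rewrite sumE even_factors_qmultinomial ?xvar_factor_neq0 //.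
(* The denominator cancels against the numerator of the multinomial coefficient. *)
rewrite mulrA divfK; last exact: even_factors_neq0.
have prod_neq0 : \prod_(m <- floors) even_factors xvar m != 0.
  by rewrite prodf_seq_neq0; apply/allP=> m _; apply: even_factors_neq0.
apply: (canRL (mulfK prod_neq0)); rewrite mulrC.
have a_le : (a <= n)%N by rewrite -ltnS; apply: ltn_ord.
have prefix_neq0 : \prod_(1 <= j < a.+1) (1 - xvar ^+ j) != 0.
  rewrite big_nat prodf_seq_neq0; apply/allP=> j _.
  by apply/implyP=> /andP[j0 _]; apply: xvar_factor_neq0.
(* With the factors for [j <= a] restored, the numerator is the sum for the empty set. It remains to
   cut all the components, the one of 0 accounting for exactly these factors. *)
apply: (mulfI prefix_neq0); rewrite -big_cat_nat //= -(qsum_pred0 n) big_map.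
case: cs csP cs_le cs_s cs_n @floors @mt sumE prod_neq0 {csJ}
  => [|[a1 b] cs] csP cs_le cs_s cs_n floors mt sumE prod_neq0.
  have a0 : a = 0%N by apply: min_outsideE; rewrite ?csP.
  rewrite a0 /= !big_nil !mul1r; exact: eq_qsum.
have /andP[/= _ cs_le'] := cs_le; have /andP[/= bn cs_n'] := cs_n.
have out k : (k <= b.+1)%N -> ~~ covered cs k by apply: covered_path cs_s.
have cs0 : all (fun p => p.1 != 0)%N cs.
  apply/allP=> p p_cs; apply: contraNneq (out 0%N isT) => p0.
  by apply/hasP; exists p; rewrite ?p0.
case: a1 csP cs_le cs_s cs_n @floors @mt sumE prod_neq0
  => [|a1] csP cs_le cs_s cs_n floors mt sumE prod_neq0; last first.
  have a0 : a = 0%N.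
    by apply: min_outsideE => //; rewrite csP; apply: out.
  rewrite a0 big_nil mul1r /= (all_filterP cs0) qsum_covered //=.
(* Here 0 is in the first component, and [a] is the last position of its block. *)
have ab : a = b.+1.
  apply: min_outsideE => // [k kb|]; rewrite csP /=; first by rewrite -ltnS kb.
  by rewrite ltnn /= out.
rewrite /= mulrCA.
have -> : qsum n xvar odd (covered ((0, b) :: cs)%N)
    = qsum n xvar odd (add_block (covered cs) 0 b.+1).
  by apply: eq_qsum => k _; rewrite /add_block ltnS orbC.
rewrite ab qsum_add_central_block //.
rewrite (all_filterP cs0) qsum_covered //; exact: path_sorted cs_s.
Qed.
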